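(* Let $\mathcal{H}$ be a real Hilbert space, let $F:\mathcal{H}\rightrightarrows\mathcal{H}$ be a set-valued mapping with $\operatorname{zer}F\ne\varnothing$, let $v:\mathcal{H}\to\mathcal{H}$ be a single-valued mapping defined on all of $\mathcal{H}$ such that the pair $(F,v)$ is monotone, and let $(\gamma_n)_{n\in\mathbb{N}}$ be a sequence of positive real numbers such that $\operatorname{ran}v\subseteq\operatorname{ran}(\gamma_nF+v)$ for all $n\in\mathbb{N}$. Let $x_0\in\operatorname{ran}v$ be arbitrary and let $(x_n)_{n\in\mathbb{N}}$ be generated by $$x_{n+1}=T_{\gamma_nF}^v(x_n),\qquad n\ge0.$$ Then the following hold: (i) If $F$ has a strongly-weakly closed graph, $v^{-1}$ is well-defined and weakly continuous, and $\sum_{n=0}^{+\infty}\gamma_n^2=+\infty$, then $(x_n)_{n\in\mathbb{N}}$ converges weakly to a point $\tilde x$ such that $v^{-1}(\tilde x)$ is a solution of $0\in F(x)$. (ii) If the pair $(F,v)$ is $\alpha$-strongly monotone for some $\alpha\in(0,+\infty)$, $v$ is $L$-Lipschitz continuous with $L\in(0,+\infty)$, and $\gamma:=\inf_{n\in\mathbb{N}}\gamma_n>0$, then $(x_n)_{n\in\mathbb{N}}$ converges with linear rate $\frac{1}{1+\alpha\gamma L^{-2}}$ to a point $\tilde x$ (i.e. $\|x_{n+1}-\tilde x\|\le\frac{1}{1+\alpha\gamma L^{-2}}\|x_n-\tilde x\|$ for all $n\in\mathbb{N}$) such that $v^{-1}(\tilde x)$ is a solution of $0\in F(x)$.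
   Context: For a set-valued mapping $F:\mathcal{H}\rightrightarrows\mathcal{H}$: $\operatorname{ran}F=\bigcup_xF(x)$, $\operatorname{zer}F=\{x:0\in F(x)\}$, $\operatorname{gra}F=\{(x,y):y\in F(x)\}$, $F^{-1}(y)=\{x:y\in F(x)\}$. Transformed resolvent: $T_{\gamma F}^v=v\circ(\gamma F+v)^{-1}$, i.e. $T_{\gamma F}^v(x)=\{v(z): x\in\gamma F(z)+v(z)\}$, with domain $\operatorname{ran}(\gamma F+v)$. When $(F,v)$ is monotone it is single-valued on its domain, and $T_{\gamma F}^v(x)$ denotes the unique element. The pair $(F,v)$ is monotone if $\langle x^*-y^*, v(x)-v(y)\rangle\ge 0$ for all $x,y\in\mathcal{H}$, $x^*\in F(x)$, $y^*\in F(y)$; it is $\alpha$-strongly monotone ($\alpha>0$) if $\langle x^*-y^*, v(x)-v(y)\rangle\ge\alpha\|x-y\|^2$ for all such $x,y,x^*,y^*$. $F$ has a strongly-weakly closed graph if whenever $(x_n,y_n)\in\operatorname{gra}F$ with $x_n\rightharpoonup x$ (weakly) and $y_n\to y$ (strongly), one has $y\in F(x)$. A single-valued map $G:\mathcal{H}\to\mathcal{H}$ is weakly continuous if $x_n\rightharpoonup x$ implies $G(x_n)\rightharpoonup G(x)$ for every sequence $(x_n)$. ''$v^{-1}$ is well-defined'' means that $v$ is bijective from $\mathcal{H}$ onto $\mathcal{H}$. In (ii), $v^{-1}(\tilde x)$ denotes the preimage of $\tilde x$ under $v$, and the conclusion means that $\tilde x=v(z)$ for a single point $z$, which solves $0\in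 F(z)$.
   Formalization: In (ii), z is shown to be the only preimage of x̃ under v among points where F is nonempty, not among all points of H; the latter fails for H=ℝ, F(0)={0}, F(z)=∅ otherwise, v=0, γ_n=1. *)

(* Defs.v *)
From HB Require Import structures.
From mathcomp Require Export all_boot all_order all_algebra.
From mathcomp Require Export all_classical all_reals all_analysis.

Set Implicit Arguments.
Unset Strict Implicit.
Unset Printing Implicit Defensive.

Export Order.TTheory GRing.Theory Num.Theory.
Export numFieldNormedType.Exports.

#[global] Open Scope classical_set_scope.
#[global] Open Scope ring_scope.

(* A real Hilbert space is a complete normed module [H] over [R : realType]
   with a symmetric positive definite bilinear form [ip : {dot H for idfun}]
   inducing the norm. *)
Definition induces_norm (R : realType) (H : completeNormedModType R)
    (ip : {dot H for idfun}) : Prop :=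
  forall x : H, ip x x = `|x| ^+ 2.

(* A set-valued mapping is a function [F : H -> set H]; [F x y] reads y ∈ F(x). *)
Section SetValued.
Context (R : realType) (H : completeNormedModType R).
Implicit Types (F : H -> set H) (v : H -> H) (c : R).

Definition sv_dom F : set H := [set x | F x !=set0].

Definition sv_ran F : set H := \bigcup_x F x.

Definition sv_zer F : set H := [set x | F x 0].

Definition sv_add c F v : H -> set H := fun z => [set c *: y + v z | y in F z].

(* Set-valued; it is single-valued on its domain when (F, v) is monotone. *)
Definition transf_resolvent v c F : H -> set H :=
  fun x => [set v z | z in [set z | sv_add c F v z x]].

End SetValued.

Section InnerProduct.
Context (R : realType) (H : completeNormedModType R) (ip : {dot H for idfun}).
Implicit Types (F : H -> set H) (v : H -> H).

Definition monotone_pair F v : Prop :=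
  forall x y x' y' : H, F x x' -> F y y' -> 0 <= ip (x' - y') (v x - v y).

Definition strongly_monotone_pair (alpha : R) F v : Prop :=
  forall x y x' y' : H, F x x' -> F y y' ->
    alpha * `|x - y| ^+ 2 <= ip (x' - y') (v x - v y).

(* By the Riesz representation theorem, testing against inner products is
   testing against all continuous linear functionals. *)
Definition weak_cvg (x : nat -> H) (l : H) : Prop :=
  forall u : H, (fun n => ip (x n) u) @ \oo --> (ip l u : R).

Definition strongly_weakly_closed F : Prop :=
  forall (x y : nat -> H) (lx ly : H), (forall n, F (x n) (y n)) ->
    weak_cvg x lx -> y @ \oo --> ly -> F lx ly.

Definition weakly_continuous (G : H -> H) : Prop :=
  forall (x : nat -> H) (l : H),
    weak_cvg x l -> weak_cvg (fun n => G (x n)) (G l).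

End InnerProduct.

(* Main.v *)
Require Import Defs.
From mathcomp Require Import lra ring.

(* Write x n.+1 = v (z n) and x n - x n.+1 = gamma n *: y n with y n in F (z n).
   For a zero c of F, monotonicity gives <x n - x n.+1, x n.+1 - v c> >= 0, so x is
   Fejér monotone with respect to v(zer F) and the series of
   gamma n ^ 2 * |y n| ^ 2 is bounded. Monotonicity between consecutive points
   makes |y n| nonincreasing, so divergence of the series of gamma n ^ 2 forces
   y n --> 0. If x (phi k).+1 --> l weakly, then z (phi k) --> v^-1 l weakly, and
   the closed graph makes v^-1 l a zero; Opial's argument concludes (i). For (ii),
   strong monotonicity and the Lipschitz bound give
   <x n - x n.+1, x n.+1 - v c> >= gamma n * alpha / L ^ 2 * |x n.+1 - v c| ^ 2,
   and Cauchy-Schwarz turns this into the contraction estimate. *)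

Section InnerProductSpace.
Set Implicit Arguments.
Unset Strict Implicit.
Context (R : realType) (H : completeNormedModType R) (ip : {dot H for idfun}).

(** * Limits along ultrafilters and along subsequences *)

(** The image of an ultrafilter is an ultrafilter, here one containing the compact segment
    [[- M, M]]. *)
Lemma cvg_ultra_fmap (T : Type) (G : set_system T) (f : T -> R) (M : R) :
  UltraFilter G -> (forall t, `|f t| <= M) -> cvg (f @ G).
Proof.
move=> UG fM.
have PG : ProperFilter (f @ G) by apply: fmap_proper_filter; exact: ultra_proper.
have UfG : UltraFilter (f @ G).
  split=> // G' PG' GG'; apply/seteqP; split=> // A G'A.
  have [GA|GnA] := in_ultra_setVsetC (f @^-1` A) UG; first by [].
  have : G' (A `&` ~` A) by apply: filterI => //; exact: GG'.
  by rewrite setICr => /filter_ex[].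
have fGM : (f @ G) `[- M, M]%classic.
  apply: (@filterS _ G _ setT); last exact: filterT.
  by move=> t _ /=; rewrite in_itv /= -ler_norml.
have := @segment_compact R (- M) M; rewrite compact_ultra => /(_ _ UfG fGM).
by move=> [l [_ fl]]; apply/cvg_ex; exists l.
Qed.

(** Subsequences are encoded by [k <= phi k] instead of strict monotonicity; this suffices to pass
    to limits. *)
Lemma cvg_subseq_oo (phi : nat -> nat) :
  (forall k, k <= phi k)%N -> phi @ \oo --> \oo.
Proof. by move=> phik A [N _ NA]; exists N => // k /= /leq_trans Nk; apply/NA/Nk. Qed.

Hypothesis ip_norm : induces_norm ip.

(** * Inner product algebra and the Cauchy-Schwarz inequality *)

Lemma ipC (u w : H) : ip u w = ip w u.
Proof. by rewrite hermC /= expr0 mul1r. Qed.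

Lemma ipDl (u w t : H) : ip (u + w) t = ip u t + ip w t.
Proof. exact: linearDl. Qed.

Lemma ipZl (a : R) (u t : H) : ip (a *: u) t = a * ip u t.
Proof. exact: linearZl_LR. Qed.

Lemma ipNl (u t : H) : ip (- u) t = - ip u t.
Proof. by rewrite -scaleN1r ipZl mulN1r. Qed.

Lemma ipBl (u w t : H) : ip (u - w) t = ip u t - ip w t.
Proof. by rewrite ipDl ipNl. Qed.

Lemma ipDr (u w t : H) : ip t (u + w) = ip t u + ip t w.
Proof. by rewrite ipC ipDl !(ipC t). Qed.

Lemma ipZr (a : R) (u t : H) : ip t (a *: u) = a * ip t u.
Proof. by rewrite ipC ipZl (ipC t). Qed.

Lemma ipNr (u t : H) : ip t (- u) = - ip t u.
Proof. by rewrite ipC ipNl (ipC t). Qed.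

Lemma ipBr (u w t : H) : ip t (u - w) = ip t u - ip t w.
Proof. by rewrite ipDr ipNr. Qed.

Definition ipE := (ipDl, ipDr, ipZl, ipZr, ipNl, ipNr).

Lemma ip0r (t : H) : ip t 0 = 0.
Proof. by rewrite -(scale0r (0 : H)) ipZr mul0r. Qed.

Lemma ip_eq0 (u : H) : ip u u = 0 -> u = 0.
Proof. by rewrite ip_norm => /eqP; rewrite sqrf_eq0 normr_eq0 => /eqP. Qed.

Lemma normD_sqr (u w : H) :
  `|u + w| ^+ 2 = `|u| ^+ 2 + 2 * ip u w + `|w| ^+ 2.
Proof. by rewrite -!ip_norm !ipE (ipC w u); ring. Qed.

Lemma normB_sqr (u w : H) :
  `|u - w| ^+ 2 = `|u| ^+ 2 - 2 * ip u w + `|w| ^+ 2.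
Proof. by rewrite normD_sqr ipNr normrN; ring. Qed.

Lemma ip_le_norm (u w : H) : `|ip u w| <= `|u| * `|w|.
Proof.
have [->|w0] := eqVneq w 0; first by rewrite ip0r !normr0 mulr0.
rewrite -(@ler_pXn2r _ 2) ?nnegrE ?mulr_ge0// real_normK ?num_real// exprMn.
have w2_gt0 : 0 < `|w| ^+ 2 by rewrite exprn_gt0 ?normr_gt0.
rewrite -(ler_pM2l w2_gt0) -subr_ge0.
suff <- : `| `|w| ^+ 2 *: u - ip u w *: w| ^+ 2 =
    `|w| ^+ 2 * (`|u| ^+ 2 * `|w| ^+ 2) - `|w| ^+ 2 * ip u w ^+ 2.
  exact: sqr_ge0.
by rewrite -[LHS]ip_norm !ipE (ipC w u) !ip_norm; ring.
Qed.

(** * Riesz representation, weak sequential compactness, Opial's lemma *)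

Lemma cvg_ipl (T : Type) (G : set_system T) (FG : Filter G) (x : T -> H)
    (l u : H) :
  x @ G --> l -> ip (x t) u @[t --> G] --> ip l u.
Proof.
move=> xl; apply/cvgrPdist_le => e e0.
have d0 : 0 < e / (`|u| + 1) by rewrite divr_gt0 // ltr_wpDl.
move/cvgrPdist_le : xl => /(_ _ d0); apply: filterS => t xt.
rewrite -ipBl (le_trans (ip_le_norm _ _))//.
rewrite -[leRHS](@divfK _ (`|u| + 1)) ?gt_eqF ?ltr_wpDl//.
by rewrite ler_pM// lerDl.
Qed.

(* The representer is the limit of a minimizing sequence of |u|^2 - 2 f u on
   the subspace; such sequences are Cauchy by the parallelogram identity. *)
Lemma riesz_subspace (S : set H) (f : H -> R) (M : R) :
  closed S -> S 0 -> (forall a u w, S u -> S w -> S (a *: u + w)) ->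
  (forall a u w, S u -> S w -> f (a *: u + w) = a * f u + f w) ->
  (forall u, S u -> `|f u| <= M * `|u|) ->
  exists2 w, S w & forall u, S u -> ip w u = f u.
Proof.
move=> Scl S0 Slin flin fM.
pose J u := `|u| ^+ 2 - 2 * f u.
pose A := [set J u | u in S].
have A_inf : has_inf A.
  split; first by exists (J 0); exists 0.
  (* Completing the square: [J u] is at least |u|^2 - 2 M |u|, hence at least - M^2. *)
  exists (- M ^+ 2) => _ [u Su <-]; rewrite /J.
  have := sqr_ge0 (`|u| - M); have := fM _ Su; rewrite ler_norml => /andP[_].
  by rewrite !expr2; lra.
have JA u : S u -> inf A <= J u.
  by move=> Su; apply: ge_inf; [exact: A_inf.2|exists u].
have /choice[s sP] : forall k : nat, exists s, S s /\ J s < inf A + k.+1%:R^-1.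
  move=> k; have k0 : 0 < k.+1%:R^-1 :> R by rewrite invr_gt0.
  by have [_ [u Su <-] uk] := inf_adherent k0 A_inf; exists u.
have s_dist j k : `|s j - s k| ^+ 2 <= 2 * (j.+1%:R^-1 + k.+1%:R^-1).
  have [[Sj Jj] [Sk Jk]] := (sP j, sP k).
  (* The midpoint of [s j] and [s k] lies in [S], so its [J] is at least [inf A]; it equals the mean
     of the two values minus |s j - s k|^2 / 4. *)
  have Sh : S (2^-1 *: s j) by rewrite -[X in S X]addr0; apply: Slin.
  have := JA _ (Slin 2^-1 _ _ Sk Sh).
  have fh : f (2^-1 *: s j) = 2^-1 * f (s j).
    have f0 : f 0 = 0.
      by have := flin 1 0 0 S0 S0; rewrite scale1r addr0 mul1r; lra.
    by rewrite -[X in f X]addr0 flin// f0 addr0.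
  rewrite /J flin// fh; move: Jj Jk; rewrite /J -!ip_norm !ipE (ipC (s k) (s j)).
  move: j.+1%:R^-1 k.+1%:R^-1 (f _) (f _) (ip _ _) (ip _ _) (ip _ _).
  by move=> *; lra.
have : cauchy (s @ \oo).
  apply: cauchy_exP => e e0.
  have e4 : 0 < e ^+ 2 / 4 by rewrite divr_gt0 ?exprn_gt0.
  have [N _ NP] := near_infty_natSinv_lt (PosNum e4).
  exists (s N); exists N => // k Nk; rewrite -ball_normE /=.
  rewrite -(@ltr_pXn2r _ 2) ?nnegrE ?(ltW e0)// (le_lt_trans (s_dist _ _))//.
  have /= := NP _ Nk; have /= := NP _ (leqnn N).
  by move: N.+1%:R^-1 k.+1%:R^-1 => *; lra.
move=> /cauchy_cvgP/cvg_ex[w sw]; exists w.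
  by apply: (closed_cvg S Scl _ _ sw); apply: nearW => k; exact: (sP k).1.
move=> u Su; set a := f u.
(* First variation at the minimizer: [J (t *: u + s k) - J (s k)] is at least - 1 / (k + 1), and
   only its inner product term has to pass to the limit. *)
have JS t : 0 <= 2 * t * (ip w u - a) + t ^+ 2 * `|u| ^+ 2.
  have cv : 2 * t * (ip (s k) u - a) + t ^+ 2 * `|u| ^+ 2 + k.+1%:R^-1
      @[k --> \oo] --> 2 * t * (ip w u - a) + t ^+ 2 * `|u| ^+ 2 + 0.
    apply: cvgD; last exact: cvg_harmonic.
    apply: cvgD; last exact: cvg_cst.
    by apply: cvgMr; apply: cvgB; [exact: cvg_ipl|exact: cvg_cst].
  rewrite -[leRHS]addr0 -(cvg_lim _ cv)//; apply: limr_ge.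
    by apply/cvg_ex; eexists; exact: cv.
  apply: nearW => k.
  have [Sk Jk] := sP k; have := JA _ (Slin t _ _ Su Sk).
  rewrite /J flin// -/a normD_sqr normrZ exprMn real_normK ?num_real// ipZl (ipC u).
  by move: k.+1%:R^-1 Jk => p; rewrite /J => *; lra.
have q_ge0 := sqr_ge0 `|u|; set q := `|u| ^+ 2 in JS q_ge0.
set b := ip w u - a in JS; apply/eqP; rewrite -subr_eq0 -/b.
have q1 : 0 < q + 1 by lra.
(* The minimizing choice would be - b / q; [q + 1] also covers [u = 0] and still leaves a negative
   multiple of b^2. *)
have := JS (- b / (q + 1)).
rewrite -(pmulr_rge0 _ (exprn_gt0 2 q1)).
have -> : (q + 1) ^+ 2 * (2 * (- b / (q + 1)) * b + (- b / (q + 1)) ^+ 2 * q) =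
    - (b ^+ 2 * (q + 2)) by field; rewrite gt_eqF.
rewrite oppr_ge0 pmulr_lle0; last by lra.
by rewrite le_eqVlt ltNge sqr_ge0 orbF sqrf_eq0.
Qed.

(* The weak limit w represents the limit functional along an ultrafilter. A
   subsequence phi tests well against all x m, hence against the closed span of
   the sequence, and testing against u reduces to its projection there. *)
Lemma bounded_weak_cvg_subseq (x : nat -> H) (M : R) :
  (forall n, `|x n| <= M) ->
  exists phi w, (forall k, k <= phi k)%N /\ weak_cvg ip (x \o phi) w.
Proof.
move=> xM.
have ipM n u : `|ip (x n) u| <= M * `|u|.
  by rewrite (le_trans (ip_le_norm _ _))// ler_wpM2r.
have [U [UU ooU]] := ultraFilterLemma eventually_filter.
have PU : ProperFilter U by exact: ultra_proper.
pose f u := lim (ip (x n) u @[n --> U]).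
have fE u : ip (x n) u @[n --> U] --> f u.
  exact: (cvg_ultra_fmap UU (fun n => ipM n u)).
have [|//|//|||w _ wf] := @riesz_subspace setT f M.
- exact: closedT.
- move=> a u t _ _; apply: cvg_lim => //.
  under eq_cvg do rewrite ipDr ipZr.
  by apply: cvgD => //; apply: cvgMr.
- move=> u _; rewrite -(cvg_lim _ (cvg_norm (fE u)))//.
  apply: limr_le; first by apply/cvg_ex; eexists; apply: cvg_norm; exact: fE.
  by apply: nearW => n; exact: ipM.
have /choice[phi phiP] : forall k, exists n, (k <= n)%N /\
    forall m : 'I_k.+1, `|ip w (x m) - ip (x n) (x m)| < k.+1%:R^-1.
  (* Finitely many closeness conditions and the tail from [k] on all belong to [U], so some index
     meets them together. *)
  move=> k; apply: (@filter_ex _ U); apply: filterI.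
    by apply: ooU; exists k.
  apply: filter_forall => m.
  have := fE (x m); rewrite -wf// => /cvgrPdist_lt; apply.
  by rewrite invr_gt0.
exists phi, w; split; first by move=> k; have [] := phiP k.
pose S := [set u | ip (x (phi k)) u @[k --> \oo] --> ip w u].
have Sx m : S (x m).
  apply/cvgrPdist_lt => e e0.
  have [N _ NP] := near_infty_natSinv_lt (PosNum e0).
  exists (maxn N m) => // k /=; rewrite geq_max => /andP[Nk mk].
  rewrite -ltnS in mk.
  by rewrite (lt_trans ((phiP k).2 (Ordinal mk)))//; exact: NP.
have S0 : S 0 by rewrite /S /= ip0r; under eq_cvg do rewrite ip0r; exact: cvg_cst.
have Slin a u t : S u -> S t -> S (a *: u + t).
  move=> Su St; rewrite /S /= ipDr ipZr; under eq_cvg do rewrite ipDr ipZr.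
  by apply: cvgD => //; apply: cvgMr.
have Scl : closed S.
  move=> u Su; apply/cvgrPdist_lt => e e0.
  (* [M + |w|] bounds every |w - x (phi k)|; adding 1 makes it a valid divisor. *)
  have c0 : 0 < M + `|w| + 1 by rewrite ltr_wpDl// addr_ge0// (le_trans _ (xM 0)).
  have d0 : 0 < e / 2 / (M + `|w| + 1) by rewrite !divr_gt0.
  have [s [Ss]] := Su _ (nbhsx_ballx _ _ d0).
  rewrite -ball_normE /= => us.
  have e2 : 0 < e / 2 by rewrite divr_gt0.
  have /cvgrPdist_lt/(_ _ e2) := Ss; apply: filterS => k sk.
  have -> : ip w u - ip (x (phi k)) u =
      ip w s - ip (x (phi k)) s + ip (w - x (phi k)) (u - s).
    by rewrite !ipE; ring.
  rewrite (le_lt_trans (ler_normD _ _))// [ltRHS]splitr ltrD//.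
  rewrite (le_lt_trans (ip_le_norm _ _))// mulrC.
  apply: (@le_lt_trans _ _ (`|u - s| * (M + `|w| + 1))).
    rewrite ler_wpM2l// (le_trans (ler_normB _ _))// addrC.
    by rewrite (le_trans (lerD (xM _) (lexx _)))// lerDl.
  by rewrite -ltr_pdivlMr.
move=> u.
have [||p Sp pu] := @riesz_subspace S (ip u) `|u| Scl S0 Slin.
- by move=> a t t' _ _; rewrite ipDr ipZr.
- by move=> t _; exact: ip_le_norm.
have xp n : ip (x n) u = ip (x n) p by rewrite ipC -pu// ipC.
have fp : f u = f p by congr (lim (_ @ U)); apply/funext => n; exact: xp.
rewrite wf// fp -wf//; under eq_cvg do rewrite /= xp.
exact: Sp.
Qed.

(* Opial's argument: for c, c' in C the difference |x n - c|^2 - |x n - c'|^2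
   converges, so <x n, c - c'> converges and two weak cluster points agree. *)
Lemma opial (x : nat -> H) (C : set H) :
  C !=set0 -> (forall c, C c -> cvgn (fun n => `|x n - c|)) ->
  (forall phi l, (forall k, k <= phi k)%N -> weak_cvg ip (x \o phi) l -> C l) ->
  exists2 l, C l & weak_cvg ip x l.
Proof.
move=> [c Cc] distC weakC.
have [M xM] : exists M, forall n, `|x n| <= M.
  have /cvg_seq_bounded[M [_ Mb]] := distC _ Cc.
  exists (M + 1 + `|c|) => n; rewrite -{1}(subrK c (x n)).
  rewrite (le_trans (ler_normD _ _))// lerD2r.
  by have := Mb (M + 1) (ltr_pwDr ltr01 (lexx _)) n I; rewrite /= normr_id.
have [phi [w [phik xw]]] := bounded_weak_cvg_subseq xM.
have Cw := weakC _ _ phik xw.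
exists w => // u; apply/cvgrPdist_lt => e e0; apply: contrapT => xu.
(* If weak convergence fails at [u], arbitrarily late terms keep a gap [e]; a weak cluster point
   [w'] of these terms must equal [w], contradicting the gap. *)
have /choice[psi psiP] : forall N, exists n, (N <= n)%N /\ e <= `|ip w u - ip (x n) u|.
  move=> N; apply: contrapT => noN; apply: xu; exists N => // n Nn.
  by rewrite ltNge; apply/negP => en; apply: noN; exists n.
have [phi' [w' [phik' xw']]] :=
  bounded_weak_cvg_subseq (fun n => xM (psi n)).
have psik' k : (k <= psi (phi' k))%N.
  by rewrite (leq_trans (phik' k))//; have [] := psiP (phi' k).
have Cw' : C w' by exact: (weakC (psi \o phi')).
have [a xa] : exists a : R, ip (x n) (w - w') @[n --> \oo] --> a.
  have /cvg_ex[b xb] := distC _ Cw; have /cvg_ex[b' xb'] := distC _ Cw'.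
  exists (2^-1 * (b' * b' - b * b + `|w| ^+ 2 - `|w'| ^+ 2)).
  have -> : (fun n => ip (x n) (w - w')) = fun n => 2^-1 *
      (`|x n - w'| * `|x n - w'| - `|x n - w| * `|x n - w|
       + `|w| ^+ 2 - `|w'| ^+ 2).
    by apply/funext => n; rewrite -!(expr2 `|x n - _|) !normB_sqr ipBr; field.
  apply: cvgMr; apply: cvgB; last exact: cvg_cst.
  apply: cvgD; last exact: cvg_cst.
  by apply: cvgB; apply: cvgM.
have aw : a = ip w (w - w').
  apply: cvg_unique (xw _) => //.
  by apply: (cvg_comp phi _ _ xa); exact: cvg_subseq_oo.
have aw' : a = ip w' (w - w').
  apply: cvg_unique (xw' _) => //.
  by apply: (cvg_comp (psi \o phi') _ _ xa); exact: cvg_subseq_oo.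
have /eqP : w - w' = 0 by apply: ip_eq0; rewrite ipBl -aw -aw' subrr.
rewrite subr_eq0 => /eqP ww'.
have /cvgrPdist_lt/(_ _ e0)/filter_ex[k] := xw' u.
by rewrite -ww' /= ltNge (psiP (phi' k)).2.
Qed.

(** * One-step estimates and decay from a divergent series *)

Lemma le_norm_sqr_step (a b c : H) :
  0 <= ip (a - b) (b - c) -> `|b - c| ^+ 2 + `|a - b| ^+ 2 <= `|a - c| ^+ 2.
Proof.
move=> abc; have -> : a - c = (a - b) + (b - c) by rewrite subrKA.
by rewrite (normD_sqr (a - b)) [leLHS]addrC lerD2r lerDl mulr_ge0.
Qed.

(** The hypothesis gives (1 + k) |b|^2 <= <a, b> <= |a| |b|; dividing by |b| concludes. *)
Lemma norm_contraction_step (k : R) (a b : H) :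
  0 < 1 + k -> k * `|b| ^+ 2 <= ip (a - b) b -> `|b| <= (1 + k)^-1 * `|a|.
Proof.
move=> k0; rewrite ipBl ip_norm lerBrDr => kab.
have [->|b0] := eqVneq b 0.
  by rewrite normr0 mulr_ge0// invr_ge0 ltW.
rewrite ler_pdivlMl// -(ler_pM2r (_ : 0 < `|b|)) ?normr_gt0//.
rewrite -mulrA -expr2 mulrDl mul1r addrC; apply: le_trans kab _.
exact: le_trans (ler_norm _) (ip_le_norm _ _).
Qed.

End InnerProductSpace.

(** If [a] stayed above [e], the partial sums of [b] would be at most [M / e]; monotonicity spreads
    one small value to all later indices. *)
Lemma nonincreasing_small_of_dvg_series (R : realType) (a b : nat -> R) (M : R) :
  (forall n, 0 <= b n) -> (\sum_(0 <= n <oo) (b n)%:E = +oo)%E ->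
  (forall N, \sum_(0 <= n < N) b n * a n <= M) ->
  {homo a : m n / (m <= n)%N >-> n <= m} ->
  forall e, 0 < e -> \forall n \near \oo, a n < e.
Proof.
move=> b0 bdvg abM adecr e e0.
suff [N aN] : exists N, a N < e.
  by exists N => // n /= Nn; rewrite (le_lt_trans (adecr _ _ Nn)).
apply: contrapT => noN.
have ea n : e <= a n by rewrite leNgt; apply/negP => an; apply: noN; exists n.
suff : (\sum_(0 <= n <oo) (b n)%:E <= (M / e)%:E)%E by rewrite bdvg leye_eq.
apply: lime_le.
  by apply: is_cvg_nneseries => n _ _; rewrite lee_fin.
apply: nearW => N; rewrite sumEFin lee_fin ler_pdivlMr// (le_trans _ (abM N))//.
by rewrite mulr_suml; apply: ler_sum => n _; apply: ler_wpM2l.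
Qed.

Theorem theorem4p5 (R : realType) (H : completeNormedModType R)
    (ip : {dot H for idfun}) (ip_norm : induces_norm ip)
    (F : H -> set H) (zerF : sv_zer F !=set0)
    (v : H -> H) (Fv_mono : monotone_pair ip F v)
    (gamma : nat -> R) (gamma_gt0 : forall n, 0 < gamma n)
    (ran_sub : forall n, range v `<=` sv_ran (sv_add (gamma n) F v))
    (x : nat -> H) (x0_ran : range v (x 0%N))
    (xS : forall n, transf_resolvent v (gamma n) F (x n) (x n.+1)) :
  (* (i) *)
  (forall vinv : H -> H,
     strongly_weakly_closed ip F ->
     cancel v vinv -> cancel vinv v -> weakly_continuous ip vinv ->
     (\sum_(0 <= n <oo) (gamma n ^+ 2)%:E = +oo)%E ->
     exists xt : H, weak_cvg ip x xt /\ sv_zer F (vinv xt))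
  /\
  (* (ii) *)
  (forall alpha L : R,
     0 < alpha -> strongly_monotone_pair ip alpha F v ->
     0 < L -> L.-lipschitz v ->
     0 < inf (range gamma) ->
     exists xt : H,
       [/\ x @ \oo --> xt,
           forall n, `|x n.+1 - xt|
             <= (1 + alpha * inf (range gamma) * L ^- 2)^-1 * `|x n - xt|
         & exists z : H,
             [/\ sv_zer F z, v z = xt
               & forall z' : H, sv_dom F z' -> v z' = xt -> z' = z]]).
Proof.
have [c Fc] := zerF.
have /choice[ZY ZYP] : forall n, exists zy : H * H,
    [/\ F zy.1 zy.2, x n.+1 = v zy.1 & x n - x n.+1 = gamma n *: zy.2].
  move=> n; have [z [y Fzy <-] <-] := xS n.
  by exists (z, y); split => //=; rewrite addrK.
pose z n := (ZY n).1; pose y n := (ZY n).2.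
have Fzy n : F (z n) (y n) by have [] := ZYP n.
have xz n : x n.+1 = v (z n) by have [] := ZYP n.
have xy n : x n - x n.+1 = gamma n *: y n by have [] := ZYP n.
have step_ge0 n d : F d 0 -> 0 <= ip (x n - x n.+1) (x n.+1 - v d).
  move=> Fd; rewrite xy ipZl mulr_ge0 ?(ltW (gamma_gt0 n))// xz.
  by rewrite -[y n]subr0; apply: Fv_mono.
have fejer n d : F d 0 -> `|x n.+1 - v d| ^+ 2 + `|x n - x n.+1| ^+ 2
    <= `|x n - v d| ^+ 2.
  by move=> Fd; apply: (le_norm_sqr_step ip_norm); exact: step_ge0.
split.
- move=> vinv Fcl vK vinvK vinv_cont gamma_dvg.
  have y_le n : `|y n.+1| <= `|y n|.
    (* Here [v (z n) - v (z n.+1)] is [x n.+1 - x n.+2], that is [gamma n.+1 *: y n.+1], so the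
       positive factor [gamma n.+1] cancels. *)
    have := Fv_mono _ _ _ _ (Fzy n) (Fzy n.+1).
    rewrite -!xz xy ipZr pmulr_rge0// => yy.
    have := le_norm_sqr_step ip_norm (_ : 0 <= ip (y n - y n.+1) (y n.+1 - 0)).
    rewrite !subr0 => /(_ yy) yn.
    by rewrite -(@ler_pXn2r _ 2) ?nnegrE// (le_trans _ yn)// lerDl sqr_ge0.
  have y_small : forall e, 0 < e -> \forall n \near \oo, `|y n| ^+ 2 < e.
    apply: (@nonincreasing_small_of_dvg_series _ _ (fun n => gamma n ^+ 2)
      (`|x 0%N - v c| ^+ 2)) => //.
    - by move=> n; exact: sqr_ge0.
    (* Keeping the remaining squared distance on the left lets the Fejér inequality telescope by
       induction. *)
    - move=> N; suff : \sum_(0 <= n < N) gamma n ^+ 2 * `|y n| ^+ 2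
          + `|x N - v c| ^+ 2 <= `|x 0%N - v c| ^+ 2.
        by apply: le_trans; rewrite lerDl sqr_ge0.
      elim: N => [|N IH]; first by rewrite big_geq// add0r.
      apply: le_trans IH; rewrite big_nat_recr//= -addrA lerD2l.
      by have := fejer N _ Fc; rewrite addrC xy normrZ gtr0_norm// exprMn.
    - by apply/nonincreasing_seqP => n; rewrite lerXn2r ?nnegrE.
  have y0 : y @ \oo --> (0 : H).
    apply/cvgrPdist_lt => e e0.
    apply: filterS (y_small _ (exprn_gt0 2 e0)) => n.
    by rewrite sub0r normrN ltr_pXn2r ?nnegrE// ltW.
  (* The shifted sequence is used because [vinv (x n.+1)] is [z n], the point paired with [y n] in
     the graph; [C] is v(zer F) written through [vinv]. *)
  have [|d|phi l phik xl|l Cl xl] :=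
      opial ip_norm (x := fun n => x n.+1) (C := [set l | F (vinv l) 0]).
  + by exists (v c); rewrite /= vK.
  + move=> Fd; rewrite -(vinvK d).
    apply: nonincreasing_is_cvgn; last by exists 0 => _ [n _ <-].
    apply/nonincreasing_seqP => n.
    rewrite -(@ler_pXn2r _ 2) ?nnegrE// (le_trans _ (fejer n.+1 _ Fd))//.
    by rewrite lerDl sqr_ge0.
  + apply: (Fcl (z \o phi) (y \o phi)).
    * by move=> k; exact: Fzy.
    * have -> : z \o phi = fun k => vinv (x (phi k).+1).
        by apply/funext => k /=; rewrite xz vK.
      exact: (vinv_cont (fun k => x (phi k).+1)).
    * by apply: (cvg_comp phi y _ y0); exact: cvg_subseq_oo.
  + exists l; split=> // u.
    by rewrite -(cvg_shiftS (fun n => ip (x n) u)); exact: xl.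
- move=> alpha L alpha0 Fv_strong L0 vL g0; set g := inf (range gamma) in g0 *.
  have gle n : g <= gamma n.
    by apply: ge_inf; [exists 0 => _ [k _ <-]; exact: ltW|exists n].
  have k0 : 0 < alpha * g * L ^- 2 by rewrite !mulr_gt0 ?invr_gt0 ?exprn_gt0.
  have rate n : `|x n.+1 - v c|
      <= (1 + alpha * g * L ^- 2)^-1 * `|x n - v c|.
    apply: (norm_contraction_step ip_norm); first by rewrite addr_gt0.
    have -> : x n - v c - (x n.+1 - v c) = gamma n *: y n.
      by rewrite -xy opprB addrA subrK.
    have zc := Fv_strong _ _ _ _ (Fzy n) Fc; rewrite subr0 -xz in zc.
    rewrite ipZl.
    have vLc : `|x n.+1 - v c| ^+ 2 <= L ^+ 2 * `|z n - c| ^+ 2.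
      rewrite -exprMn ler_pXn2r ?nnegrE ?mulr_ge0 ?(ltW L0)// xz.
      exact: (vL (z n, c)).
    (* Strong monotonicity bounds the inner product below by this quantity; then [gamma n] is
       lowered to [g], and |z n - c|^2 to |x n.+1 - v c|^2 / L^2. *)
    apply: (@le_trans _ _ (gamma n * (alpha * `|z n - c| ^+ 2))); last first.
      by rewrite ler_pM2l.
    apply: (@le_trans _ _ (g * (alpha * `|z n - c| ^+ 2))); last first.
      by rewrite ler_wpM2r// mulr_ge0// ltW.
    rewrite (mulrC alpha) -!mulrA ler_pM2l// ler_pM2l//.
    by rewrite ler_pdivrMl ?exprn_gt0.
  exists (v c); split => //.
  + set q := (1 + _)^-1 in rate.
    have q0 : 0 < q by rewrite invr_gt0 addr_gt0.
    have q1 : q < 1 by rewrite invf_lt1 ?addr_gt0// ltrDl.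
    have geom n : `|v c - x n| <= q ^+ n * `|v c - x 0%N|.
      elim: n => [|n IH]; first by rewrite expr0 mul1r.
      rewrite distrC (le_trans (rate n))// exprS -mulrA distrC.
      by rewrite ler_wpM2l// ltW.
    have cv : q ^+ n * `|v c - x 0%N| @[n --> \oo] --> 0.
      rewrite -(mul0r `|v c - x 0%N|); apply: cvgMl; apply: cvg_expr.
      by rewrite ger0_norm// ltW.
    apply/cvgrPdist_lt => e e0.
    move/cvgrPdist_lt : cv => /(_ _ e0); apply: filterS => n.
    rewrite sub0r normrN; apply: le_lt_trans.
    exact: le_trans (geom n) (ler_norm _).
  (* When [v d = v c], strong monotonicity reduces to alpha |d - c|^2 <= 0. *)
  + exists c; split => // d [d' Fd] vd.
    have := Fv_strong _ _ _ _ Fd Fc; rewrite vd subrr ip0r pmulr_rle0//.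
    rewrite le_eqVlt ltNge sqr_ge0 orbF sqrf_eq0 normr_eq0 subr_eq0.
    by move/eqP.
Qed.
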